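(* Let $M$ be a fixed countably infinite domain, let $\mathcal L$ be either Łukasiewicz, Product, or Gödel first-order real-valued logic without equality, and let $\vDash_{\mathcal L}$ be the corresponding consequence relation. For any finite set $\varphi_1,\ldots,\varphi_k,\psi$ of $\mathcal L$-sentences, $$\langle\varphi_1;\{1\}\rangle,\ldots,\langle\varphi_k;\{1\}\rangle\vdash_M\langle\psi;\{1\}\rangle\quad\text{iff}\quad\varphi_1,\ldots,\varphi_k\vDash_{\mathcal L}\psi.$$
   Context: The connectives of Łukasiewicz, Product and Gödel logic are interpreted on $[0,1]$ by: $\wedge=\min$, $\vee=\max$, constants $0,1$, the t-norm $\&$ ($\max\{0,x+y-1\}$ for Łukasiewicz, $x\cdot y$ for Product, $\min\{x,y\}$ for Gödel), and its residuum $\to$, i.e. $x\to y=\max\{z\mid x\mathbin{\&}z\le y\}$; negation is $\neg x = x\to 0$. The vocabulary $\tau$ is first-order, relational and without equality. Models. A model $\mathfrak M$ with non-empty domain $M$ interprets each $n$-ary predicate $R\in\tau$ by a map $R_{\mathfrak M}\colon M^n\to[0,1]$. Truth-values: $\|P[\overline a]\|_{\mathfrak M}=P_{\mathfrak M}(\overline a)$; $\|\circ(\varphi_1,\ldots,\varphi_n)[\overline a]\|_{\mathfrak M}=\circ(\|\varphi_1[\overline a]\|_{\mathfrak M},\ldots,\|\varphi_n[\overline a]\|_{\mathfrak M})$; $\|(\forall x)\varphi[\overline a]\|_{\mathfrak M}=\inf\{\|\varphi[\overline a,e]\|_{\mathfrak M}\mid e\in M\}$; $\|(\exists x)\varphi[\overline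 a]\|_{\mathfrak M}=\sup\{\|\varphi[\overline a,e]\|_{\mathfrak M}\mid e\in M\}$. $\varphi_1,\ldots,\varphi_k\vDash_{\mathcal L}\psi$ means that in every model (with arbitrary domain) in which all of $\varphi_1,\ldots,\varphi_k$ take value $1$, $\psi$ takes value $1$. MD-sentences. An MD-sentence with domain $M$ is an expression $\langle\varphi_1(\overline x_{\varphi_1}),\ldots,\varphi_k(\overline x_{\varphi_k});S\rangle$, where each $\varphi_i$ is a first-order formula whose free variables are exactly those in the list $\overline x_{\varphi_i}=x_{i_1},\ldots,x_{i_{n_i}}$ and $S\subseteq[0,1]^{M^{n_1}}\times\cdots\times[0,1]^{M^{n_k}}$ (for $n_i=0$ the corresponding component is an element of $[0,1]$). Good tuples. For a $j$-ary connective $\circ$ and functions $f_1,\ldots,f_j$ from Cartesian powers of $M$ to $[0,1]$ associated with formulas, $\circ(f_1,\ldots,f_j)$ is the function obtained by applying $\circ$ to the outputs of the $f_i$'s (arguments being taken componentwise, matched according to the free variables). Given an MD-sentence $\langle\varphi_1,\ldots,\varphi_k;S\rangle$, a tuple $\langle f_1,\ldots,f_k\rangle\in S$ is good if: (a) $f_m=\circ(f_{m_1},\ldots,f_{m_j})$ whenever $\varphi_m=\circ(\varphi_{m_1},\ldots,\varphi_{m_j})$; (b) whenever $\varphi_i=\forall y\,\varphi_j$, $f_i(e_1,\ldots,e_{n_i})=\inf\{f_j(e_1,\ldots,e_{n_i},e)\mid e\in M\}$ for all $e_1,\ldots,e_{n_i}\in M$; (c) whenever $\varphi_i=\exists y\,\varphi_j$,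 $f_i(e_1,\ldots,e_{n_i})=\sup\{f_j(e_1,\ldots,e_{n_i},e)\mid e\in M\}$ for all $e_1,\ldots,e_{n_i}\in M$ (in (b),(c) $e$ is placed in the argument position of $y$). Proof system (the MD-system of $M$). Axiom (1): $\langle\varphi_1,\ldots,\varphi_k;[0,1]^{M^{n_1}}\times\cdots\times[0,1]^{M^{n_k}}\rangle$ for all formulas $\varphi_1,\ldots,\varphi_k$. Rule (2): from $\langle\varphi_1,\ldots,\varphi_k;S\rangle$ infer $\langle\varphi_{\pi(1)},\ldots,\varphi_{\pi(k)};S'\rangle$, where $\pi$ is a permutation of $1,\ldots,k$ and $S'=\{\langle f_{\pi(1)},\ldots,f_{\pi(k)}\rangle\mid\langle f_1,\ldots,f_k\rangle\in S\}$. Rule (3): from $\langle\varphi_1,\ldots,\varphi_k;S\rangle$ infer $\langle\varphi_1,\ldots,\varphi_k,\varphi_{k+1},\ldots,\varphi_m;S\times[0,1]^{M^{n_{k+1}}}\times\cdots\times[0,1]^{M^{n_m}}\rangle$. Rule (4): from $\langle\varphi_1,\ldots,\varphi_k;S_1\rangle$ and $\langle\varphi_1,\ldots,\varphi_k;S_2\rangle$ infer $\langle\varphi_1,\ldots,\varphi_k;S_1\cap S_2\rangle$. Rule (5): for $0<r<k$, from $\langle\varphi_1,\ldots,\varphi_k;S\rangle$ infer $\langle\varphi_1,\ldots,\varphi_{k-r};S'\rangle$, where $S'=\{\langle f_1,\ldots,f_{k-r}\rangle\mid\langle f_1,\ldots,f_k\rangle\in S\}$. Rule (6): from $\langle\varphi_1,\ldots,\varphi_k;S\rangle$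 infer $\langle\varphi_1,\ldots,\varphi_k;S'\rangle$ whenever $S\subseteq S'$. Rule (7): from $\langle\varphi_1,\ldots,\varphi_k;S\rangle$ infer $\langle\varphi_1,\ldots,\varphi_k;S'\rangle$, where $S'$ is the set of good tuples in $S$. $\Gamma\vdash_M\gamma$ means that there is a finite sequence of MD-sentences ending in $\gamma$, each element of which is an axiom, a member of $\Gamma$, or follows from previous elements by one of the rules.
   Formalization: Good tuples must also satisfy: components of atomic formulas with the same predicate agree whenever it is applied to the same elements of M; with (a)–(c) alone the claim fails, e.g. ∀yP(y) would not be derivable from ∀xP(x). *)

(* Defs.v *)
From HB Require Import structures.
From mathcomp Require Export all_boot all_order all_fingroup all_algebra.
From mathcomp Require Export interval_inference all_classical all_reals.
From mathcomp Require Import lra.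

Set Implicit Arguments.
Unset Strict Implicit.
Unset Printing Implicit Defensive.

Import Order.TTheory GRing.Theory Num.Theory.

Local Open Scope classical_set_scope.
Local Open Scope ring_scope.

Inductive logic := Lukasiewicz | Product | Godel.

Inductive binop := Conj | Disj | Strong | Impl.

Section Connectives.
Context {R : realType}.
Implicit Types x y z : R.

Definition tnorm (L : logic) x y : R :=
  match L with
  | Lukasiewicz => Num.max 0 (x + y - 1)
  | Product => x * y
  | Godel => Num.min x y
  end.

(* The residuum is the maximum of this set; the supremum is attained, see
   residuum_max. *)
Definition residuum (L : logic) x y : R :=
  sup [set z : R | 0 <= z <= 1 /\ tnorm L x z <= y].

Lemma residuum_max (L : logic) x y : 0 <= x <= 1 -> 0 <= y <= 1 ->
  [/\ 0 <= residuum L x y <= 1, tnorm L x (residuum L x y) <= y &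
      forall z, 0 <= z <= 1 -> tnorm L x z <= y -> z <= residuum L x y].
Proof.
move=> /andP[x0 x1] /andP[y0 y1].
suff [w [w01 wy wmax]] : exists w, [/\ 0 <= w <= 1, tnorm L x w <= y &
    forall z, 0 <= z <= 1 -> tnorm L x z <= y -> z <= w].
  suff -> : residuum L x y = w by split.
  apply/eqP; rewrite eq_le; apply/andP; split.
    apply: ge_sup; first by exists w.
    by move=> z [z01 zy]; exact: wmax.
  apply: ub_le_sup; last by split.
  by exists 1 => z [/andP[_ z1] _].
have [xy|yx] := leP x y.
  exists 1; split; first by rewrite ler01 lexx.
    case: L => /=; first by rewrite addrK ge_max y0 xy.
      by rewrite mulr1.
    by rewrite ge_min xy.
  by move=> z /andP[].
case: L => /=.
- exists (1 - x + y); split; first by apply/andP; split; lra.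
  + by rewrite ge_max y0; lra.
  + by move=> z _; rewrite ge_max y0/=; lra.
- have x_gt0 : 0 < x by apply: le_lt_trans yx.
  exists (y / x); split.
  + by rewrite divr_ge0//= ler_pdivrMr// mul1r ltW.
  + by rewrite mulrC divfK ?gt_eqF.
  + by move=> z _ h; rewrite ler_pdivlMr// mulrC.
- exists y; split; first by rewrite y0 y1.
  + by rewrite ge_min lexx orbT.
  + by move=> z _; rewrite ge_min leNgt yx.
Qed.

Definition binop_val (L : logic) (b : binop) : R -> R -> R :=
  match b with
  | Conj => Num.min
  | Disj => Num.max
  | Strong => tnorm L
  | Impl => residuum L
  end.

Definition neg_val (L : logic) x : R := residuum L x 0.

End Connectives.

Record vocabulary := Vocabulary { predicate : Type; arity : predicate -> nat }.

(* Individual variables are natural numbers. *)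
Inductive formula (tau : vocabulary) :=
| Atom (P : predicate tau) of (arity P).-tuple nat
| Zero
| One
| Neg of formula tau
| Bin of binop & formula tau & formula tau
| Forall of nat & formula tau
| Exists of nat & formula tau.

Arguments Zero {tau}.
Arguments One {tau}.

Fixpoint free_vars tau (phi : formula tau) : seq nat :=
  match phi with
  | Atom _ xs => xs
  | Zero | One => [::]
  | Neg phi1 => free_vars phi1
  | Bin _ phi1 phi2 => free_vars phi1 ++ free_vars phi2
  | Forall y phi1 | Exists y phi1 => [seq x <- free_vars phi1 | x != y]
  end.

Record sentence tau := Sentence {
  sentence_formula :> formula tau;
  _ : free_vars sentence_formula == [::] }.

Record model (R : realType) tau := Model {
  domain :> Type;
  domain_inhabited : inhabited domain;
  interp : forall P : predicate tau, (arity P).-tuple domain -> {i01 R} }.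

Fixpoint truth R tau (L : logic) (A : model R tau) (phi : formula tau)
    (v : nat -> A) : R :=
  match phi with
  | Atom P xs => (interp (map_tuple v xs))%:num
  | Zero => 0
  | One => 1
  | Neg phi1 => neg_val L (truth L phi1 v)
  | Bin b phi1 phi2 => binop_val L b (truth L phi1 v) (truth L phi2 v)
  | Forall y phi1 =>
      inf [set truth L phi1 [eta v with y |-> e] | e in [set: A]]
  | Exists y phi1 =>
      sup [set truth L phi1 [eta v with y |-> e] | e in [set: A]]
  end.

Definition satisfies R tau (L : logic) (A : model R tau) (phi : sentence tau) :=
  forall v : nat -> A, truth L phi v = 1.

Definition entails (R : realType) tau (L : logic) k
    (phi : 'I_k -> sentence tau) (psi : sentence tau) :=
  forall A : model R tau,
    (forall i, satisfies L A (phi i)) -> satisfies L A psi.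

(* A formula phi(x_1, ..., x_n) together with a repetition-free list of exactly
   its free variables. *)
Record lformula tau := LFormula {
  lform :> formula tau;
  lvars : seq nat;
  _ : perm_eq lvars (undup (free_vars lform)) }.

Lemma sentence_lformula_subproof tau (phi : sentence tau) :
  perm_eq [::] (undup (free_vars phi)).
Proof. by case: phi => phi /= /eqP ->. Qed.

Definition sentence_lformula tau (phi : sentence tau) : lformula tau :=
  LFormula (sentence_lformula_subproof phi).

Section MD.
Context (R : realType) (M : Type) (tau : vocabulary) (L : logic).

(* [0,1]^(M^n), n being the length of the list of variables of phi. *)
Definition component (phi : lformula tau) : Type :=
  (size (lvars phi)).-tuple M -> {i01 R}.

(* The value of f : component phi at the arguments given by an assignment v of
   the variables; this is how the arguments of components belonging to
   different formulas are matched according to their free variables. *)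
Definition at_assignment (phi : lformula tau) (f : component phi)
    (v : nat -> M) : R := (f (map_tuple v (in_tuple (lvars phi))))%:num.

Definition ftuple k (phi : 'I_k -> lformula tau) : Type :=
  forall i : 'I_k, component (phi i).

(* An MD-sentence has at least one formula: there are md_len.+1 of them. *)
Record mdsentence := MDSentence {
  md_len : nat;
  md_formulas : 'I_md_len.+1 -> lformula tau;
  md_set : set (ftuple md_formulas) }.

(* The last clause makes the components of atomic formulas with the same
   predicate symbol agree whenever that predicate is applied to the same
   elements of M, as in any structure with domain M. Without it the components
   of, say, P(x), P(y) and P(x, x), P(x, y) would be unrelated, and already
   (forall y, P(y)) would not be derivable from (forall x, P(x)). *)
Definition good k (phi : 'I_k -> lformula tau) (f : ftuple phi) : Prop :=
  let val i v := at_assignment (f i) v in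
  [/\ [/\ forall m, lform (phi m) = Zero -> forall v, val m v = 0,
          forall m, lform (phi m) = One -> forall v, val m v = 1,
          forall m i, lform (phi m) = Neg (phi i) ->
            forall v, val m v = neg_val L (val i v) &
          forall m i j b, lform (phi m) = Bin b (phi i) (phi j) ->
            forall v, val m v = binop_val L b (val i v) (val j v)],
      forall i j y, lform (phi i) = Forall y (phi j) ->
        forall v, val i v =
          inf [set val j [eta v with y |-> e] | e in [set: M]],
      forall i j y, lform (phi i) = Exists y (phi j) ->
        forall v, val i v =
          sup [set val j [eta v with y |-> e] | e in [set: M]] &
      forall i j (P : predicate tau) (s t : (arity P).-tuple nat),
        lform (phi i) = Atom s -> lform (phi j) = Atom t ->
        forall v w, map_tuple v s = map_tuple w t -> val i v = val j w].

(* For the permutation rule, lists of formulas are functions on indices, so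
   that <phi_pi(1), ..., phi_pi(k)> is phi \o pi. In md_project the number of
   remaining formulas is n.+1 = k.+1 - r with 0 < r < k.+1. *)
Inductive infer (Prev : set mdsentence) : mdsentence -> Prop :=
| md_axiom k (phi : 'I_k.+1 -> lformula tau) :
    infer Prev (@MDSentence k phi setT)
| md_permute k (phi : 'I_k.+1 -> lformula tau) (S : set (ftuple phi))
    (p : {perm 'I_k.+1}) :
    Prev (MDSentence S) ->
    infer Prev (@MDSentence k (fun i => phi (p i))
                  [set (fun i => f (p i)) | f in S])
| md_extend k m (km : (k.+1 <= m.+1)%N) (phi : 'I_m.+1 -> lformula tau)
    (S : set (ftuple (fun i => phi (widen_ord km i)))) :
    Prev (MDSentence S) ->
    infer Prev (@MDSentence m phi [set f | S (fun i => f (widen_ord km i))])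
| md_intersect k (phi : 'I_k.+1 -> lformula tau) (S1 S2 : set (ftuple phi)) :
    Prev (MDSentence S1) -> Prev (MDSentence S2) ->
    infer Prev (MDSentence (S1 `&` S2))
| md_project n k (nk : (n.+1 < k.+1)%N) (phi : 'I_k.+1 -> lformula tau)
    (S : set (ftuple phi)) :
    Prev (MDSentence S) ->
    infer Prev (@MDSentence n (fun i => phi (widen_ord (ltnW nk) i))
                  [set (fun i => f (widen_ord (ltnW nk) i)) | f in S])
| md_weaken k (phi : 'I_k.+1 -> lformula tau) (S S' : set (ftuple phi)) :
    S `<=` S' -> Prev (MDSentence S) -> infer Prev (MDSentence S')
| md_good k (phi : 'I_k.+1 -> lformula tau) (S : set (ftuple phi)) :
    Prev (MDSentence S) ->
    infer Prev (MDSentence [set f | S f /\ good f]).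

Definition derivation (Gamma : set mdsentence) (s : seq mdsentence) : Prop :=
  forall s1 g s2, s = s1 ++ g :: s2 ->
    Gamma g \/ infer (fun h => List.In h s1) g.

Definition derivable (Gamma : set mdsentence) (g : mdsentence) : Prop :=
  exists s, derivation Gamma (rcons s g).

(* <phi; {1}> for a sentence phi, which has an empty list of free variables. *)
Definition md_one (phi : sentence tau) : mdsentence :=
  @MDSentence 0 (fun=> sentence_lformula phi)
    [set f | (f ord0 [tuple])%:num = 1].

End MD.

Arguments md_one R M {tau} phi.

(* Main.v *)
Require Import Defs.
From mathcomp Require Import lra.

(** Both sides are equivalent to consequence over the models with domain [M].

    Every rule preserves membership of the tuple of truth functions of a fixed
    model on [M] in the set of an MD-sentence; for the goodness rule this is
    because a tuple of truth functions is good ([good_truth_tuple]).  So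
    derivability gives consequence over the models with domain [M]
    ([md_soundness]).

    Consequence over the domain [M] is consequence over all domains.  For a
    model [A] of any cardinality, it suffices to find a map [g : M -> A], not
    necessarily injective, such that the model pulled back along [g] gives the
    relevant sentences their values in [A].  A downward Loewenheim-Skolem
    argument provides [g]: the infima and suprema at quantifiers are determined
    by countably many witnesses, because every subset of the real line has a
    countable dense subset ([dense_sequence]), and the closure of a point under
    countably many choices of witnesses is the image of a countable set of
    Skolem terms ([closed_enumeration], [exists_witnesses],
    [truth_pullback]).  Since there is no equality, distinct elements of [M] may
    stand for the same element of [A], which deals with finite [A] too.

    Conversely, if the consequence holds, list the sentences and all their
    subformulas.  Extension, permutation and intersection derive the set of
    those tuples over this list in which the premises have value one, and the
    goodness rule cuts it down to the good ones.  A good tuple over a list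
    closed under subformulas consists of the truth functions of a model on [M],
    read off from the components of the atomic formulas ([good_model]), so in
    all these tuples the conclusion has value one as well; projection and
    weakening finish ([md_completeness]). *)

Set Implicit Arguments.
Unset Strict Implicit.
Unset Printing Implicit Defensive.

Import Order.TTheory GRing.Theory Num.Theory.

Local Open Scope classical_set_scope.
Local Open Scope card_scope.
Local Open Scope ring_scope.

(** * The unit interval and dense subsets of real sets *)

Section UnitInterval.
Context {R : realType}.
Implicit Types (X Y : set R) (x y : R).

Lemma residuum01 L x y : 0 <= x <= 1 -> 0 <= y <= 1 -> 0 <= residuum L x y <= 1.
Proof. by move=> x01 y01; have [] := residuum_max L x01 y01. Qed.

Lemma binop_val01 L b x y :
  0 <= x <= 1 -> 0 <= y <= 1 -> 0 <= binop_val L b x y <= 1.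
Proof.
move=> x01 y01; case: b => /=; last exact: residuum01.
- by rewrite le_min ge_min; move/andP: x01 => [-> ->]; case/andP: y01 => ->.
- by rewrite le_max ge_max; move/andP: x01 => [-> ->]; case/andP: y01 => _ ->.
move: x01 y01 => /andP[x0 x1] /andP[y0 y1]; case: L => /=.
- by rewrite le_max lexx ge_max ler01 /= lerBlDr lerD.
- by rewrite mulr_ge0 // mulr_ile1.
- by rewrite le_min x0 y0 ge_min x1.
Qed.

Lemma sup01 X : X !=set0 -> (forall x, X x -> 0 <= x <= 1) -> 0 <= sup X <= 1.
Proof.
move=> [x Xx] X01; apply/andP; split; last first.
  by apply: ge_sup; [exists x | move=> y /X01/andP[]].
apply: (@le_trans _ _ x); first by case/andP: (X01 _ Xx).
by apply: ub_le_sup => //; exists 1 => y /X01/andP[].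
Qed.

Lemma inf01 X : X !=set0 -> (forall x, X x -> 0 <= x <= 1) -> 0 <= inf X <= 1.
Proof.
move=> [x Xx] X01; apply/andP; split.
  by apply: lb_le_inf; [exists x | move=> y /X01/andP[]].
apply: (@le_trans _ _ x); last by case/andP: (X01 _ Xx).
by apply: ge_inf => //; exists 0 => y /X01/andP[].
Qed.

Definition dense_in X Y :=
  forall y, Y y -> forall eps, 0 < eps -> exists2 x, X x & `|x - y| < eps.

Lemma sup_dense X Y : X !=set0 -> X `<=` Y -> has_ubound Y -> dense_in X Y ->
  sup X = sup Y.
Proof.
move=> X0 XY ubY XdY.
have ubX : has_ubound X by case: ubY => b Yb; exists b => x /XY/Yb.
apply/eqP; rewrite eq_le; apply/andP; split.
  by apply: ge_sup => // x /XY Yx; exact: ub_le_sup.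
apply: ge_sup; first by case: X0 => x /XY ?; exists x.
move=> y Yy; apply/ler_addgt0Pr => eps eps0.
have [x Xx] := XdY y Yy eps eps0; rewrite ltr_distl => /andP[yx _].
have : x <= sup X := ub_le_sup ubX Xx.
by move: yx; lra.
Qed.

Lemma inf_dense X Y : X !=set0 -> X `<=` Y -> has_lbound Y -> dense_in X Y ->
  inf X = inf Y.
Proof.
move=> X0 XY lbY XdY; rewrite /inf; congr (- _); apply: sup_dense.
- by case: X0 => x Xx; exists (- x), x.
- by move=> _ [x /XY Yx <-]; exists x.
- by case: lbY => b Yb; exists (- b) => _ [y /Yb ? <-]; rewrite lerN2.
- move=> _ [y Yy <-] eps /(XdY _ Yy)[x Xx xy]; exists (- x); first by exists x.
  by rewrite -opprD normrN.
Qed.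

(** The real line is second countable: it is enough to pick, for each rational
    interval that the image of [h] meets, one point that [h] sends into it. *)
Lemma dense_sequence (T : Type) (x0 : T) (h : T -> R) :
  exists u : nat -> T, dense_in (range (h \o u)) (range h).
Proof.
pose hits (pq : rat * rat) t := ratr pq.1 < h t < (ratr pq.2 : R).
have /choice[u uP] n : exists t, forall pq, unpickle n = Some pq ->
    (exists z, hits pq z) -> hits pq t.
  case En : (unpickle n : option (rat * rat)) => [pq|]; last by exists x0.
  have [[z hz]|no] := pselect (exists z, hits pq z).
    by exists z => _ [<-].
  by exists x0 => _ [<-] /no.
exists u => _ [y _ <-] eps eps0.
have lo : h y - eps < h y by lra.
have hi : h y < h y + eps by lra.
have [p] := rat_in_itvoo lo; have [q] := rat_in_itvoo hi.
rewrite !in_itv /= => /andP[q1 q2] /andP[p1 p2].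
exists (h (u (pickle (p, q)))); first by exists (pickle (p, q)).
have /andP[hp hq] : ratr p < h (u (pickle (p, q))) < ratr q.
  by apply: (uP _ (p, q)); [rewrite pickleK | exists y; rewrite /hits /= p2 q1].
by rewrite ltr_distl; apply/andP; split; lra.
Qed.

End UnitInterval.

(** * Truth values *)

Section Truth.
Context (R : realType) (L : logic) (tau : vocabulary).
Implicit Type A : model R tau.

Lemma truth01 A phi (v : nat -> A) : 0 <= truth L phi v <= 1.
Proof.
have [a] := domain_inhabited A.
elim: phi v => [P xs|||phi IH|b phi IH1 chi IH2|y phi IH|y phi IH] v /=.
- by rewrite ge0 le1.
- by rewrite lexx ler01.
- by rewrite ler01 lexx.
- by apply: residuum01 => //; rewrite lexx ler01.
- exact: binop_val01.
- by apply: inf01 => [|_ [e _ <-]//]; exists (truth L phi [eta v with y |-> a]), a.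
- by apply: sup01 => [|_ [e _ <-]//]; exists (truth L phi [eta v with y |-> a]), a.
Qed.

Lemma eq_truth A phi (v w : nat -> A) :
  {in free_vars phi, v =1 w} -> truth L phi v = truth L phi w.
Proof.
elim: phi v w => [P xs|||phi IH|b phi IH1 chi IH2|y phi IH|y phi IH] v w //= vw.
- congr ((interp _)%:num); apply: val_inj; exact/eq_in_map.
- by congr neg_val; exact: IH.
- congr binop_val; [apply: IH1 | apply: IH2] => x xv; apply: vw;
    by rewrite mem_cat xv ?orbT.
- congr inf; apply: eq_imagel => e _; apply: IH => x xv /=.
  by case: eqVneq => // xy; apply: vw; rewrite mem_filter xy.
- congr sup; apply: eq_imagel => e _; apply: IH => x xv /=.
  by case: eqVneq => // xy; apply: vw; rewrite mem_filter xy.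
Qed.

Lemma truth_sentence A (phi : sentence tau) (v w : nat -> A) :
  truth L phi v = truth L phi w.
Proof. by case: phi => phi /= /eqP phi0; apply: eq_truth => x; rewrite phi0. Qed.

Lemma fresh_bound (phi : formula tau) :
  exists n, {in free_vars phi, forall x, (x < n)%N}.
Proof.
exists (\max_(x <- free_vars phi) x).+1 => x xphi.
by rewrite ltnS (@leq_bigmax_seq _ _ xpredT id).
Qed.

End Truth.

Fixpoint subformulas tau (phi : formula tau) : seq (formula tau) :=
  phi :: match phi with
         | Neg phi1 | Forall _ phi1 | Exists _ phi1 => subformulas phi1
         | Bin _ phi1 phi2 => subformulas phi1 ++ subformulas phi2
         | _ => [::]
         end.

Lemma In_cat (T : Type) (x : T) s t :
  List.In x (s ++ t) <-> List.In x s \/ List.In x t.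
Proof. exact: List.in_app_iff. Qed.

Lemma In_map (S T : Type) (f : S -> T) x s : List.In x s -> List.In (f x) (map f s).
Proof. exact: List.in_map. Qed.

Lemma In_mem (T : eqType) (x : T) s : x \in s -> List.In x s.
Proof.
by elim: s => //= y s IH; rewrite inE => /orP[/eqP->|/IH]; [left | right].
Qed.

Lemma In_nth (T : Type) (x0 x : T) s : List.In x s ->
  exists2 i, (i < size s)%N & nth x0 s i = x.
Proof.
elim: s => [//|y s IH] /= [<-|/IH[i si <-]]; first by exists 0%N.
by exists i.+1.
Qed.

Lemma subformulas_refl tau (phi : formula tau) : List.In phi (subformulas phi).
Proof. by case: phi; left. Qed.

Definition all_subformulas tau (ss : seq (sentence tau)) : seq (formula tau) :=
  flatten [seq subformulas (sentence_formula s) | s <- ss].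

Lemma In_all_subformulas tau (ss : seq (sentence tau)) s chi :
  List.In s ss -> List.In chi (subformulas s) -> List.In chi (all_subformulas ss).
Proof.
elim: ss => [//|t ss IH] /= [->|ss_s] chis; apply/In_cat; first by left.
by right; exact: IH.
Qed.

(** * The downward Loewenheim-Skolem theorem *)

Section LowenheimSkolem.
Context (R : realType) (L : logic) (tau : vocabulary).
Implicit Type A : model R tau.

Definition pullback A (M : Type) (m0 : M) (g : M -> A) : model R tau :=
  Model (inhabits m0) (fun P (xs : (arity P).-tuple M) => interp (map_tuple g xs)).

Lemma update_comp (S T : Type) (g : S -> T) (v : nat -> S) y e :
  g \o [eta v with y |-> e] = [eta g \o v with y |-> g e].
Proof. by apply/funext => x /=; case: ifP. Qed.

(** A Tarski-Vaught condition: the image of [g] need not contain exact witnesses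
    for infima and suprema, which may not be attained, but it approximates all
    the values that a quantifier over [A] ranges over. *)
Definition witnesses A (M : Type) (g : M -> A) (phi : formula tau) :=
  forall y (v : nat -> M),
    dense_in (range (fun m => truth L phi [eta g \o v with y |-> g m]))
             (range (fun e => truth L phi [eta g \o v with y |-> e])).

(** The Tarski-Vaught test.  At a quantifier the pulled back model takes the
    infimum or supremum over a dense part of the values in [A]. *)
Lemma truth_pullback A (M : Type) (m0 : M) (g : M -> A) (phi : formula tau) :
  (forall chi, List.In chi (subformulas phi) -> witnesses g chi) ->
  forall v : nat -> M,
    truth L phi (v : nat -> pullback m0 g) = truth L phi (g \o v).
Proof.
elim: phi => [P xs|||phi IH|b phi IH1 chi IH2|y phi IH|y phi IH] gw v //=.
- by congr ((interp _)%:num); apply: val_inj; rewrite /= map_comp.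
- by rewrite IH // => chi' ?; apply: gw; right.
- by rewrite IH1 ?IH2 // => chi' ?; apply: gw; right; apply/In_cat; [right|left].
- have gphi : forall chi, List.In chi (subformulas phi) -> witnesses g chi.
    by move=> chi ?; apply: gw; right.
  rewrite (_ : (fun e : M => _) =
      (fun m => truth L phi [eta g \o v with y |-> g m])); last first.
    by apply/funext => e; rewrite (IH gphi) update_comp.
  apply: inf_dense.
  + by exists (truth L phi [eta g \o v with y |-> g m0]), m0.
  + by move=> _ [m _ <-]; exists (g m).
  + by exists 0 => _ [e _ <-]; case/andP: (truth01 L phi [eta g \o v with y |-> e]).
  + exact: gphi (subformulas_refl phi) y v.
- have gphi : forall chi, List.In chi (subformulas phi) -> witnesses g chi.
    by move=> chi ?; apply: gw; right.
  rewrite (_ : (fun e : M => _) =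
      (fun m => truth L phi [eta g \o v with y |-> g m])); last first.
    by apply/funext => e; rewrite (IH gphi) update_comp.
  apply: sup_dense.
  + by exists (truth L phi [eta g \o v with y |-> g m0]), m0.
  + by move=> _ [m _ <-]; exists (g m).
  + by exists 1 => _ [e _ <-]; case/andP: (truth01 L phi [eta g \o v with y |-> e]).
  + exact: gphi (subformulas_refl phi) y v.
Qed.

(** Finitely branching trees serve as closed Skolem terms: a leaf is a constant
    and a node labelled [c] is an application of [F c].  They form a countable
    type, which makes the closure of [t0] under all the [F c] countable. *)
Fixpoint eval_skolem (T : Type) (t0 : T) (F : nat -> seq T -> T)
    (t : GenTree.tree unit) : T :=
  match t with
  | GenTree.Leaf _ => t0
  | GenTree.Node c ts => F c (map (eval_skolem t0 F) ts)
  end.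

Lemma closed_enumeration (T : Type) (t0 : T) (F : nat -> seq T -> T) :
  exists g : nat -> T, forall c s, exists n, g n = F c (map g s).
Proof.
pose term n : GenTree.tree unit := odflt (GenTree.Leaf tt) (unpickle n).
exists (eval_skolem t0 F \o term) => c s.
by exists (pickle (GenTree.Node c (map term s))); rewrite /= /term pickleK /= -map_comp.
Qed.

Lemma exists_witnesses A (l : seq (formula tau)) :
  exists g : nat -> A, forall phi, List.In phi l -> witnesses g phi.
Proof.
have [a0] := domain_inhabited A.
have /choice[u uP] (iys : nat * nat * seq A) : exists u : nat -> A,
    let h e := truth L (nth Zero l iys.1.1) [eta nth a0 iys.2 with iys.1.2 |-> e] in
    dense_in (range (h \o u)) (range h).
  exact: dense_sequence a0 _.
(* The code of [(i, y, n)] stands for the Skolem function giving the [n]-th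
   witness for variable [y] in the [i]-th formula, its arguments being the
   values of the first few variables. *)
pose F c s := let: (i, y, n) := odflt (0%N, 0%N, 0%N) (unpickle c) in u (i, y, s) n.
have [g gF] := closed_enumeration a0 F.
exists g => phi phil y v.
have [i _ <-] := In_nth Zero phil.
(* Only the variables below [k] matter, so the assignment can be replaced by the
   finite list of its first values, on which Skolem functions operate. *)
have [k kphi] := fresh_bound (nth Zero l i).
pose s := map v (iota 0 k).
have truthE e : truth L (nth Zero l i) [eta g \o v with y |-> e] =
    truth L (nth Zero l i) [eta nth a0 (map g s) with y |-> e].
  apply: eq_truth => x /kphi xk /=; case: ifP => // _.
  by rewrite /s -map_comp (nth_map 0%N) ?size_iota // nth_iota.
move=> _ [e _ <-] eps eps0; rewrite truthE.
have [_ [n _ <-] /= un] := uP (i, y, map g s) _ (imageT _ e) eps eps0.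
have [m gm] := gF (pickle (i, y, n)) s.
exists (truth L (nth Zero l i) [eta g \o v with y |-> g m]); first by exists m.
by rewrite truthE gm /F pickleK.
Qed.

End LowenheimSkolem.

(** * Derivations *)

Section Derivations.
Context (R : realType) (M : Type) (tau : vocabulary) (L : logic).
Implicit Types (Gamma : set (mdsentence R M tau)) (g : mdsentence R M tau).

Lemma infer_mono (Prev Prev' : set (mdsentence R M tau)) g :
  Prev `<=` Prev' -> infer L Prev g -> infer L Prev' g.
Proof. by move=> sub; case=> *; by econstructor; eauto. Qed.

Lemma derivation_catl Gamma s t : derivation L Gamma (s ++ t) -> derivation L Gamma s.
Proof. by move=> D s1 g s2 E; apply: (D s1 g (s2 ++ t)); rewrite E -catA. Qed.

Lemma derivation_rcons Gamma s g : derivation L Gamma s ->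
  Gamma g \/ infer L (fun h => List.In h s) g -> derivation L Gamma (rcons s g).
Proof.
move=> D Dg s1 h s2; case/lastP: s2 => [|s2 h'].
  by rewrite cats1 => /rcons_inj[<- <-].
by rewrite -rcons_cons -rcons_cat => /rcons_inj[E _]; exact: D E.
Qed.

Lemma derivation_cat Gamma s t :
  derivation L Gamma s -> derivation L Gamma t -> derivation L Gamma (s ++ t).
Proof.
move=> Ds; elim/last_ind: t => [|t g IH] Dt; first by rewrite cats0.
rewrite -rcons_cat; apply: derivation_rcons.
  by apply: IH; apply: (@derivation_catl _ t [:: g]); rewrite cats1.
have [|Gg|D] := Dt t g [::]; [by rewrite cats1 | by left | right].
by apply: infer_mono D => h ht; apply/In_cat; right.
Qed.

Lemma derivable_common Gamma (l : seq (mdsentence R M tau)) :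
  (forall g, List.In g l -> derivable L Gamma g) ->
  exists2 s, derivation L Gamma s & forall g, List.In g l -> List.In g s.
Proof.
elim: l => [|g l IH] Dl; first by exists [::] => // -[].
have [|s Ds ls] := IH; first by move=> h hl; apply: Dl; right.
have [|t Dt] := Dl g; first by left.
exists (rcons t g ++ s); first exact: derivation_cat.
move=> h /= [<-|/ls hs]; apply/In_cat; last by right.
by left; rewrite -cats1; apply/In_cat; right; left.
Qed.

Lemma derivable_hyp Gamma g : Gamma g -> derivable L Gamma g.
Proof. by move=> Gg; exists [::]; apply: derivation_rcons; [case | left]. Qed.

(** Separately derivable premises can be gathered in one derivation as long as
    there are finitely many of them; a rule has at most two. *)
Lemma infer_finite (Prev : set (mdsentence R M tau)) g : infer L Prev g ->
  exists l : seq (mdsentence R M tau),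
    (forall h, List.In h l -> Prev h) /\ infer L (fun h => List.In h l) g.
Proof.
case=> [k phi|k phi S p PS|k m km phi S PS|k phi S1 S2 P1 P2|n k nk phi S PS
       |k phi S S' SS' PS|k phi S PS].
- by exists [::]; split=> //; constructor.
all: try (exists [:: MDSentence S]; split; first by move=> h [<-|[]]).
- by constructor; left.
- by constructor; left.
- exists [:: MDSentence S1; MDSentence S2]; split.
    by move=> h [<-|[<-|[]]].
  by constructor; [left | right; left].
- by constructor; left.
- by apply: (md_weaken _ SS'); left.
- by constructor; left.
Qed.

Lemma derivable_infer Gamma g : infer L (derivable L Gamma) g -> derivable L Gamma g.
Proof.
move=> /infer_finite[l [Dl lg]].
have [s Ds ls] := derivable_common Dl.
by exists s; apply: derivation_rcons => //; right; exact: infer_mono lg.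
Qed.

(** Together with the closure of derivability under the rules, this makes it
    possible to forget the sequences and argue by induction on the rules. *)
Lemma derivable_ind Gamma (H : set (mdsentence R M tau)) :
  Gamma `<=` H -> (forall g, infer L H g -> H g) -> derivable L Gamma `<=` H.
Proof.
move=> GH closedH g [s D]; suff HH : forall h, List.In h (rcons s g) -> H h.
  by apply: HH; rewrite -cats1; apply/In_cat; right; left.
elim/last_ind: (rcons s g) D => {s g} [//|s g IH] D h.
have Hs : forall h, List.In h s -> H h.
  by apply: IH; apply: (@derivation_catl _ s [:: g]); rewrite cats1.
rewrite -cats1 => /In_cat[/Hs//|[<-|//]].
have [|/GH//|Dg] := D s g [::]; first by rewrite cats1.
by apply: closedH; exact: infer_mono Dg.
Qed.

End Derivations.

(** * Soundness for models on the given domain *)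

Section Soundness.
Context (R : realType) (tau : vocabulary) (L : logic) (A : model R tau).

Definition assignment (a0 : A) (xs : seq nat) (t : seq A) x := nth a0 t (index x xs).

(** The arguments [t] are the values of the variables of [phi]; the default [a0]
    is only given to variables that do not occur free in [phi]. *)
Definition truth_component (a0 : A) (phi : lformula tau) : component R A phi :=
  fun t => let v := assignment a0 (lvars phi) t in
    Itv01 (proj1 (andP (truth01 L phi v))) (proj2 (andP (truth01 L phi v))).

Lemma at_truth_component a0 phi v :
  at_assignment (truth_component a0 (phi := phi)) v = truth L phi v.
Proof.
apply: eq_truth => x; case: phi => phi xs /= pxs xphi.
have xxs : x \in xs by rewrite (perm_mem pxs) mem_undup.
by rewrite /assignment (nth_map 0%N) ?index_mem // nth_index.
Qed.

Definition truth_tuple a0 k (Phi : 'I_k -> lformula tau) : ftuple R A Phi :=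
  fun i => truth_component a0 (phi := Phi i).

Arguments truth_tuple a0 {k} Phi.

Lemma good_truth_tuple a0 k (Phi : 'I_k -> lformula tau) :
  good L (truth_tuple a0 Phi).
Proof.
split; first split.
- by move=> m Em v; rewrite at_truth_component Em.
- by move=> m Em v; rewrite at_truth_component Em.
- by move=> m i Em v; rewrite !at_truth_component Em.
- by move=> m i j b Em v; rewrite !at_truth_component Em.
- move=> i j y Ei v; rewrite at_truth_component Ei /=; congr inf.
  by apply: eq_imagel => e _; rewrite at_truth_component.
- move=> i j y Ei v; rewrite at_truth_component Ei /=; congr sup.
  by apply: eq_imagel => e _; rewrite at_truth_component.
- by move=> i j P s t Ei Ej v w vw; rewrite !at_truth_component Ei Ej /= vw.
Qed.

Definition true_in a0 (g : mdsentence R A tau) :=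
  md_set (truth_tuple a0 (md_formulas (m := g))).

Lemma infer_true_in a0 g : infer L (true_in a0) g -> true_in a0 g.
Proof.
case=> [k Phi|k Phi S p|k m km Phi S|k Phi S1 S2|n k nk Phi S|k Phi S S' SS'
       |k Phi S]; rewrite /true_in //=.
- by exists (truth_tuple a0 Phi).
- by exists (truth_tuple a0 Phi).
- by move=> /SS'.
- by move=> ?; split=> //; exact: good_truth_tuple.
Qed.

Lemma true_in_md_one a0 (phi : sentence tau) :
  true_in a0 (md_one R A phi) <-> satisfies L A phi.
Proof.
rewrite /true_in /md_one /=; split=> [phi1 v|]; last exact.
by rewrite -phi1; exact: truth_sentence.
Qed.

Lemma md_soundness k (phi : 'I_k -> sentence tau) (psi : sentence tau) :
  derivable L [set md_one R A (phi i) | i in [set: 'I_k]] (md_one R A psi) ->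
  (forall i, satisfies L A (phi i)) -> satisfies L A psi.
Proof.
have [a0] := domain_inhabited A.
move=> D Aphi; apply/(true_in_md_one a0).
apply: derivable_ind D => [_ [i _ <-]|]; last exact: infer_true_in.
exact/true_in_md_one.
Qed.

End Soundness.

(** * Completeness *)

Section Completeness.
Context (R : realType) (M : Type) (tau : vocabulary) (L : logic).

Lemma perm_undup_free_vars (phi : formula tau) :
  perm_eq (undup (free_vars phi)) (undup (free_vars phi)).
Proof. exact: perm_refl. Qed.

Definition standard_lformula phi := LFormula (perm_undup_free_vars phi).

(** The last goodness condition makes the interpretation of a predicate [P] at
    [xs] independent of the atomic formula and of the assignment from which it
    is read off; predicates and arguments that the list does not reach get the
    value zero.  Goodness then repeats the recursive clauses of truth. *)
Lemma good_model (m0 : M) k (Phi : 'I_k -> lformula tau) (f : ftuple R M Phi) :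
  good L f -> exists I : forall P : predicate tau, (arity P).-tuple M -> {i01 R},
    let A := Model (inhabits m0) I in
    forall i,
      (forall chi, List.In chi (subformulas (Phi i)) ->
         exists j, lform (Phi j) = chi) ->
      forall v : nat -> M, at_assignment (f i) v = truth L (Phi i) (v : nat -> A).
Proof.
move=> [[good0 good1 goodN goodB] goodA goodE goodP].
have HI (P : predicate tau) (xs : (arity P).-tuple M) : exists z : {i01 R},
    forall i s v, lform (Phi i) = @Atom tau P s -> map_tuple v s = xs ->
      at_assignment (f i) v = z%:num.
  have [[i [s [v [Ei vs]]]]|no] := pselect (exists i s v,
      lform (Phi i) = @Atom tau P s /\ map_tuple v s = xs).
    exists (f i (map_tuple v (in_tuple (lvars (Phi i))))) => j t w Ej wt.
    by apply: goodP Ej Ei _ _ _; rewrite vs.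
  by exists 0%:i01 => i s v Ei vs; case: no; exists i, s, v.
exists (fun P xs => projT1 (cid (HI P xs))) => A i.
move Echi : (lform (Phi i)) => chi.
elim: chi i Echi => [P s|||phi IH|b phi IH1 chi IH2|y phi IH|y phi IH] i Ei sub v /=.
- by case: cid => z /= zP; exact: zP Ei _.
- exact: good0.
- exact: good1.
- have [|j Ej] := sub phi; first by right; exact: subformulas_refl.
  rewrite (goodN i j) ?Ej // (IH j Ej) // => c ?; by apply: sub; right.
- have [|j Ej] := sub phi.
    by right; apply/In_cat; left; exact: subformulas_refl.
  have [|l El] := sub chi.
    by right; apply/In_cat; right; exact: subformulas_refl.
  rewrite (goodB i j l b) ?Ej ?El // (IH1 j Ej) ?(IH2 l El) // => c ?;
    apply: sub; right; apply/In_cat; by [left | right].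
- have [|j Ej] := sub phi; first by right; exact: subformulas_refl.
  rewrite (goodA i j y) ?Ej //; congr inf; apply: eq_imagel => e _.
  by apply: IH => // c ?; apply: sub; right.
- have [|j Ej] := sub phi; first by right; exact: subformulas_refl.
  rewrite (goodE i j y) ?Ej //; congr sup; apply: eq_imagel => e _.
  by apply: IH => // c ?; apply: sub; right.
Qed.

Definition md_value_one n (Phi : 'I_n.+1 -> lformula tau) (j : 'I_n.+1) :
    mdsentence R M tau :=
  MDSentence [set f : ftuple R M Phi | forall v, at_assignment (f j) v = 1].

Implicit Type Gamma : set (mdsentence R M tau).

(** The rules produce lists of formulas as compositions of functions on indices,
    which are only pointwise equal to the lists that are wanted. *)
Lemma derivable_eq_formulas Gamma n (Phi Psi : 'I_n.+1 -> lformula tau) j :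
  Phi =1 Psi -> derivable L Gamma (md_value_one Phi j) ->
  derivable L Gamma (md_value_one Psi j).
Proof. by move=> /funext ->. Qed.

Lemma at_sentence_lformula (phi : sentence tau)
    (f : component R M (sentence_lformula phi)) v :
  at_assignment f v = (f [tuple])%:num.
Proof. by rewrite /at_assignment (tuple0 (map_tuple _ _)). Qed.

Lemma derivable_md_one Gamma (m0 : M) (phi : sentence tau) :
  derivable L Gamma (md_one R M phi) <->
  derivable L Gamma (@md_value_one 0 (fun=> sentence_lformula phi) ord0).
Proof.
split=> D; apply: derivable_infer; apply: md_weaken D => f /= fphi.
  by move=> v; rewrite at_sentence_lformula.
by rewrite -(at_sentence_lformula _ (fun=> m0)).
Qed.

(** The extension rule only adds formulas after the premise [phi]; hence the
    list [Phi] with positions [0] and [j] exchanged is built first, and the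
    permutation rule restores the order. *)
Lemma derivable_expand Gamma (m0 : M) n (Phi : 'I_n.+1 -> lformula tau) j
    (phi : sentence tau) :
  Phi j = sentence_lformula phi -> derivable L Gamma (md_one R M phi) ->
  derivable L Gamma (md_value_one Phi j).
Proof.
move=> Ej /(derivable_md_one _ m0) D.
pose p := tperm ord0 j.
have D1 : derivable L Gamma (md_value_one
    (fun i : 'I_1 => Phi (p (widen_ord (ltn0Sn n) i))) ord0).
  apply: derivable_eq_formulas D => i.
  by rewrite (_ : widen_ord _ i = ord0) ?tpermL //; apply: val_inj; rewrite /= ord1.
have w0 : widen_ord (ltn0Sn n) ord0 = ord0 by exact: val_inj.
have D2 : derivable L Gamma (md_value_one (fun i => Phi (p i)) ord0).
  apply: derivable_infer; apply: md_weaken; last first.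
    apply: derivable_infer.
    exact: (@md_extend _ _ _ _ _ _ _ (ltn0Sn n) (fun i => Phi (p i)) _ D1).
  by move=> f /=; rewrite w0.
have pj : p j = ord0 by rewrite tpermR.
have D3 : derivable L Gamma (md_value_one (fun i => Phi (p (p i))) j).
  apply: derivable_infer; apply: md_weaken; last first.
    by apply: derivable_infer; apply: md_permute D2.
  by move=> _ [f f1 <-] v; rewrite /= pj.
by apply: derivable_eq_formulas D3 => i; rewrite tpermK.
Qed.

Lemma derivable_conjunction Gamma n (Phi : 'I_n.+1 -> lformula tau) (J : seq 'I_n.+1) :
  (forall j, j \in J -> derivable L Gamma (md_value_one Phi j)) ->
  derivable L Gamma (MDSentence [set f : ftuple R M Phi |
    forall j, j \in J -> forall v, at_assignment (f j) v = 1]).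
Proof.
elim: J => [_|j J IH D].
  apply: derivable_infer; apply: md_weaken; last first.
    by apply: derivable_infer; apply: md_axiom.
  by move=> f _ j.
have DJ := IH (fun l Jl => D l (mem_behead (s := j :: J) Jl)).
apply: derivable_infer.
apply: md_weaken; last first.
  by apply: derivable_infer; apply: md_intersect (D j (mem_head j J)) DJ.
by move=> f [fj fJ] l; rewrite inE => /orP[/eqP->|/fJ].
Qed.

(** The projection rule removes at least one formula, whence [0 < n]. *)
Lemma derivable_head Gamma (m0 : M) n (Phi : 'I_n.+1 -> lformula tau)
    (psi : sentence tau) :
  (0 < n)%N -> Phi ord0 = sentence_lformula psi ->
  derivable L Gamma (md_value_one Phi ord0) ->
  derivable L Gamma (md_one R M psi).
Proof.
move=> n0 E0 D; apply/(derivable_md_one _ m0).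
have n1 : (1 < n.+1)%N by [].
have w0 : widen_ord (ltnW n1) ord0 = ord0 by exact: val_inj.
have D1 : derivable L Gamma
    (md_value_one (fun i : 'I_1 => Phi (widen_ord (ltnW n1) i)) ord0).
  apply: derivable_infer; apply: md_weaken; last first.
    by apply: derivable_infer; exact: (@md_project _ _ _ _ _ _ _ n1 Phi _ D).
  by move=> _ [f f1 <-] v; rewrite /= w0.
apply: derivable_eq_formulas D1 => i.
by rewrite -E0; congr Phi; apply: val_inj; rewrite /= ord1.
Qed.

Lemma md_completeness (m0 : M) k (phi : 'I_k -> sentence tau) (psi : sentence tau) :
  entails R L phi psi ->
  derivable L [set md_one R M (phi i) | i in [set: 'I_k]] (md_one R M psi).
Proof.
move=> phi_psi; set Gamma := image _ _.
pose ss := psi :: [seq phi i | i <- enum 'I_k].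
pose l := [seq sentence_lformula s | s <- ss] ++
          [seq standard_lformula chi | chi <- all_subformulas ss].
pose n := (size l).-1.
pose Phi (j : 'I_n.+1) := nth (sentence_lformula psi) l j.
have l_Phi chi : List.In chi l -> exists j, Phi j = chi.
  by move=> /(In_nth (sentence_lformula psi))[j jl <-]; exists (Ordinal jl).
have Phi_sub s : List.In s ss -> forall chi, List.In chi (subformulas s) ->
    exists j, lform (Phi j) = chi.
  move=> ss_s chi chi_s; have [|j Ej] := l_Phi (standard_lformula chi).
    by apply/In_cat; right; apply: In_map; exact: In_all_subformulas chi_s.
  by exists j; rewrite Ej.
have ss_phi i : List.In (phi i) ss.
  by right; apply: In_map; apply: In_mem; rewrite mem_enum.
have /choice[J PhiJ] i : exists j, Phi j = sentence_lformula (phi i).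
  by apply: l_Phi; apply/In_cat; left; exact: In_map.
apply: (@derivable_head _ m0 n Phi) => //.
  rewrite /n /l /= size_cat size_map addn_gt0; apply/orP; right.
  by rewrite size_map /all_subformulas /= size_cat; case: (sentence_formula psi).
apply: derivable_infer; apply: md_weaken; last first.
  apply: derivable_infer; apply: md_good.
  apply: (@derivable_conjunction Gamma n Phi (map J (enum 'I_k))).
  move=> _ /mapP[i _ ->]; apply: (derivable_expand m0 (PhiJ i)).
  by apply: derivable_hyp; exists i.
move=> f [/= f1 /(good_model m0)[I fI]] v.
rewrite fI; last by apply: (Phi_sub psi); left.
apply: phi_psi => i w.
have <- : at_assignment (f (J i)) w = 1.
  by apply: f1; apply/map_f; rewrite mem_enum.
by rewrite fI PhiJ //; exact: Phi_sub.
Qed.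

End Completeness.

Theorem corollary15 (R : realType) (M : Type)
    (M_countably_infinite : [set: M] #= [set: nat])
    (L : logic) (tau : vocabulary)
    (k : nat) (phi : 'I_k -> sentence tau) (psi : sentence tau) :
  derivable L [set md_one R M (phi i) | i in [set: 'I_k]] (md_one R M psi)
  <-> entails R L phi psi.
Proof.
(* A surjection from [M] onto the natural numbers turns an enumeration of
   witnesses in a model into one indexed by [M]. *)
have /pcard_eqP[e] := M_countably_infinite.
have e_surj n : exists m, e m = n.
  by have [m _ <-] := 'surj_e (I : [set: nat] n); exists m.
have [m0 _] := e_surj 0%N.
split; last exact: md_completeness.
move=> D A Aphi.
pose ss := psi :: [seq phi i | i <- enum 'I_k].
have [g gw] := exists_witnesses L A (all_subformulas ss).
have gew chi : List.In chi (all_subformulas ss) -> witnesses L (g \o e) chi.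
  move=> /gw gchi y v r /(gchi y (e \o v)) chi_e eps /chi_e[_ [n _ <-] close].
  have [m em] := e_surj n.
  by exists (truth L chi [eta (g \o e) \o v with y |-> (g \o e) m]);
    [exists m | rewrite /= em].
pose B := pullback m0 (g \o e).
have satB s : List.In s ss -> satisfies L B s <-> satisfies L A s.
  move=> ss_s.
  have truthB v : truth L s (v : nat -> B) = truth L s ((g \o e) \o v).
    apply: truth_pullback => chi chi_s; apply: gew.
    exact: In_all_subformulas chi_s.
  split=> [Bs w|As v]; last by rewrite truthB.
  by rewrite -(Bs (fun=> m0)) truthB; exact: truth_sentence.
apply/satB; first by left.
apply: (md_soundness (A := B) D) => i; apply/satB => //.
by right; apply: In_map; apply: In_mem; rewrite mem_enum.
Qed.
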